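(* Let $X$ be a toric variety with homogeneous coordinate ring $S=k[Y_1,\ldots,Y_d,Y_{d+1}^{\pm1},\ldots,Y_{d+e}^{\pm1}]$ and irrelevant ideal $B\subset S$. Let $I\subset\mathbb{Z}$ be a subset. If $P$ is a $\mathbb{Z}^{d+e}$-graded $S$-module which is $I$-homogeneous, then for every $i$ the local cohomology module $H^i_B(P)$ (with its induced $\mathbb{Z}^{d+e}$-grading) is $I$-homogeneous.
   Context: We work over an algebraically closed field $k$ of arbitrary characteristic. Let $N\simeq\mathbb{Z}^n$ be a lattice and $X=X(\Delta)$ the toric variety of a rational fan $\Delta$ in $V=N\otimes\mathbb{R}$. Let $\tau_1,\ldots,\tau_d$ be the one-dimensional cones of $\Delta$ and $e$ the codimension in $V$ of the linear span of $\Delta$. The homogeneous coordinate ring of $X$ is $S=k[Y_1,\ldots,Y_d,Y_{d+1}^{\pm1},\ldots,Y_{d+e}^{\pm1}]$ (with $Y_i$ corresponding to $\tau_i$ for $i\le d$), considered with the fine $\mathbb{Z}^{d+e}$-grading by monomials. For a cone $\sigma\in\Delta$ put $Y^{\hat\sigma}=\prod_{i\le d:\,\tau_i\not\subset\sigma}Y_i$; the ideal $B$ is generated by the monomials $Y^{\hat\sigma}$ for $\sigma$ a maximal cone of $\Delta$. Let $f_1,\ldots,f_{d+e}$ be the canonical basis of $\mathbb{Z}^{d+e}$. For $I\subset\mathbb{Z}$, a $\mathbb{Z}^{d+e}$-graded $S$-module $P$ is called $I$-homogeneous if for every $j\in\{1,\dots,d+e\}$ and every $\alpha=(\alpha_1,\dots,\alpha_{d+e})\in\mathbb{Z}^{d+e}$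 with $\alpha_j\notin I$, multiplication by $Y_j$, $P_\alpha\to P_{\alpha+f_j}$, is an isomorphism. *)

(* Defs.v *)
From HB Require Import structures.
From mathcomp Require Import all_boot all_order all_algebra.
From mathcomp Require Import boolp classical_sets functions cardinality reals.
From mathcomp Require Import mpoly.

Set Implicit Arguments.
Unset Strict Implicit.
Unset Printing Implicit Defensive.

Import Order.TTheory GRing.Theory Num.Theory.
Local Open Scope classical_set_scope.
Local Open Scope ring_scope.

(* Rational fans in V = N (x) R, with N = Z^n: lattice vectors are integer    *)
(* row vectors, embedded in V = 'rV[R]_n coordinatewise.                      *)
Section Fans.
Variables (R : realType) (n : nat).
Notation V := 'rV[R]_n.
Implicit Types (sigma tau : set V).

Definition cone_of (s : seq 'rV[int]_n) : set V :=
  [set x | exists c : nat -> R, (forall i, 0 <= c i) /\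
     x = \sum_(i < size s) c i *: map_mx intr (nth 0 s i)].

Definition rational_polyhedral sigma := exists s, sigma = cone_of s.

Definition strongly_convex sigma :=
  forall x, sigma x -> sigma (- x) -> x = 0.

(* The column vector u is a linear form on V, nonnegative on sigma. *)
Definition is_face tau sigma :=
  exists u : 'cV[R]_n, (forall x, sigma x -> 0 <= (x *m u) 0 0) /\
    tau = [set x | sigma x /\ (x *m u) 0 0 = 0].

Record fan := Fan {
  fan_cones :> set V -> Prop;
  fan_finite : finite_set (fan_cones : set (set V));
  fan_nonempty : (fan_cones : set (set V)) !=set0;
  fan_rational : forall sigma, fan_cones sigma -> rational_polyhedral sigma;
  fan_pointed : forall sigma, fan_cones sigma -> strongly_convex sigma;
  fan_face : forall sigma tau,
    fan_cones sigma -> is_face tau sigma -> fan_cones tau;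
  fan_inter : forall sigma tau, fan_cones sigma -> fan_cones tau ->
    is_face (sigma `&` tau) sigma /\ is_face (sigma `&` tau) tau }.

Definition is_linear_span (A : set V) (U : {vspace V}) :=
  (forall x, A x -> x \in U) /\
  (forall W : {vspace V}, (forall x, A x -> x \in W) -> (U <= W)%VS).

Definition one_dimensional sigma :=
  exists2 U, is_linear_span sigma U & \dim U = 1%N.

Definition enumerates_rays (Delta : fan) (d : nat) (tau : 'I_d -> set V) :=
  injective tau /\
  range tau = [set sigma | Delta sigma /\ one_dimensional sigma].

Definition has_span_codim (Delta : fan) (e : nat) :=
  exists2 U, is_linear_span (\bigcup_(sigma in (Delta : set (set V))) sigma) U
           & e = (n - \dim U)%N.

Definition maximal_cone (Delta : fan) sigma :=
  Delta sigma /\ forall sigma', Delta sigma' -> sigma `<=` sigma' ->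
    sigma' = sigma.

End Fans.

(* S = k[Y_1,...,Y_d,Y_(d+1)^+-1,...,Y_(d+e)^+-1], realised inside the        *)
(* fraction field of k[Y_1,...,Y_(d+e)] as the set of p / (Y_(d+1)...Y_(d+e))^m *)
Section CoxRing.
Variables (k : closedFieldType) (d e : nat).
Notation Frac := {fraction {mpoly k[d + e]}}.

Definition laurent_den : Frac :=
  \prod_(j < e) tofrac ('X_(rshift d j) : {mpoly k[d + e]}).

Definition cox_pred : {pred Frac} := fun x =>
  `[< exists (p : {mpoly k[d + e]}) (m : nat), x = tofrac p / laurent_den ^+ m >].

Lemma mpolyX_neq0 (j : 'I_(d + e)) : 'X_j != 0 :> {mpoly k[d + e]}.
Proof.
by apply/eqP => /(congr1 (fun p => p@_U_(j)))/eqP;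
   rewrite mcoeffX eqxx mcoeff0 oner_eq0.
Qed.

Lemma laurent_den_neq0 : laurent_den != 0.
Proof.
by apply/prodf_neq0 => j _; rewrite tofrac_eq0 mpolyX_neq0.
Qed.

Lemma cox_pred_subring : subring_closed cox_pred.
Proof.
have D0 m : laurent_den ^+ m != 0 by rewrite expf_neq0 ?laurent_den_neq0.
have denE m : laurent_den ^+ m =
    tofrac ((\prod_(j < e) 'X_(rshift d j) : {mpoly k[d + e]}) ^+ m).
  by rewrite /laurent_den rmorphXn rmorph_prod.
split.
- by apply/asboolP; exists 1, 0%N; rewrite rmorph1 expr0 divr1.
- move=> _ _ /asboolP[p [m ->]] /asboolP[q [l ->]]; apply/asboolP.
  exists (p * (\prod_(j < e) 'X_(rshift d j)) ^+ l
          - q * (\prod_(j < e) 'X_(rshift d j)) ^+ m), (m + l)%N.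
  rewrite rmorphB !rmorphM /= -!denE exprD mulrBl.
  congr (_ - _); first by rewrite -mulf_div divff ?mulr1.
  by rewrite [_ ^+ m * _ ^+ l]mulrC -mulf_div divff ?mulr1.
- move=> _ _ /asboolP[p [m ->]] /asboolP[q [l ->]]; apply/asboolP.
  by exists (p * q), (m + l)%N; rewrite rmorphM /= exprD mulf_div.
Qed.

HB.instance Definition _ :=
  GRing.isSubringClosed.Build Frac cox_pred cox_pred_subring.

Record coxRing := CoxRing { cox_val : Frac; _ : cox_val \in cox_pred }.

HB.instance Definition _ := [isSub of coxRing for cox_val].
HB.instance Definition _ := [Choice of coxRing by <:].
HB.instance Definition _ := [SubChoice_isSubComNzRing of coxRing by <:].

Lemma coxvar_subproof (j : 'I_(d + e)) :
  tofrac ('X_j : {mpoly k[d + e]}) \in cox_pred.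
Proof. by apply/asboolP; exists 'X_j, 0%N; rewrite expr0 divr1. Qed.

Definition coxvar (j : 'I_(d + e)) : coxRing := CoxRing (coxvar_subproof j).

Notation Z := 'rV[int]_(d + e).

(* The homogeneous elements c * Y^a; when a has a negative entry among the    *)
(* first d ones, only 0 is of this form in S.                                 *)
Definition cox_degree (a : Z) : set coxRing :=
  [set s | exists c : k, cox_val s =
     tofrac (c%:MP : {mpoly k[d + e]}) *
     \prod_(j < d + e) tofrac ('X_j : {mpoly k[d + e]}) ^ a 0 j].

Lemma cox_degree1 : cox_degree 0 1.
Proof.
exists 1; rewrite mpolyC1 !rmorph1 mul1r big1 // => j _.
by rewrite mxE expr0z.
Qed.

Lemma cox_degreeM a b s t :
  cox_degree a s -> cox_degree b t -> cox_degree (a + b) (s * t).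
Proof.
move=> [c sE] [c' tE]; exists (c * c').
rewrite [LHS](rmorphM (val : coxRing -> Frac)) /= sE tE mpolyCM rmorphM mulrACA.
congr (_ * _); rewrite -big_split; apply: eq_bigr => j _ /=.
by rewrite mxE expfzDr // tofrac_eq0 mpolyX_neq0.
Qed.

Lemma cox_degree_var j : cox_degree (delta_mx 0 j) (coxvar j).
Proof.
exists 1; rewrite mpolyC1 rmorph1 mul1r (bigD1 j) //= mxE !eqxx expr1z.
by rewrite big1 ?mulr1 // => i ij; rewrite mxE (negbTE ij) andbF expr0z.
Qed.

Record gradedModule := GradedModule {
  gm_sort :> lmodType coxRing;
  gm_comp : Z -> set gm_sort;
  gm_comp0 : forall a, gm_comp a 0;
  gm_compB : forall a x y, gm_comp a x -> gm_comp a y -> gm_comp a (x - y);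
  gm_scale : forall a b s x,
    cox_degree b s -> gm_comp a x -> gm_comp (a + b) (s *: x);
  gm_dec : forall x, exists (s : seq Z) (f : Z -> gm_sort),
    [/\ uniq s, (forall a, gm_comp a (f a)) & x = \sum_(a <- s) f a];
  gm_indep : forall (s : seq Z) (f : Z -> gm_sort),
    uniq s -> (forall a, gm_comp a (f a)) -> \sum_(a <- s) f a = 0 ->
    forall a, a \in s -> f a = 0 }.

Record gradedHom (M N : gradedModule) := GradedHom {
  gh_fun :> {linear M -> N};
  gh_degree : forall a x, gm_comp a x -> gm_comp a (gh_fun x) }.

Definition I_homogeneous (I : set int) (P : gradedModule) :=
  forall (j : 'I_(d + e)) (a : Z), ~ I (a 0 j) ->
    set_bij (@gm_comp P a) (@gm_comp P (a + delta_mx 0 j))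
            (fun x => coxvar j *: x).

Record gradedSub (M : gradedModule) := GradedSub {
  gs_set :> M -> Prop;
  gs_submod : submod_closed (mem (gs_set : set M));
  gs_homog : forall (s : seq Z) (f : Z -> M),
    uniq s -> (forall a, gm_comp a (f a)) -> gs_set (\sum_(a <- s) f a) ->
    forall a, a \in s -> gs_set (f a) }.

Lemma gs0 M (W : gradedSub M) : W 0.
Proof. by have [/set_mem] := gs_submod W. Qed.

Lemma gsP M (W : gradedSub M) c x y : W x -> W y -> W (c *: x + y).
Proof.
move=> Wx Wy; have [_ h] := gs_submod W.
by apply: set_mem; apply: h; apply: mem_set.
Qed.

Lemma gsD M (W : gradedSub M) x y : W x -> W y -> W (x + y).
Proof. by move=> Wx Wy; rewrite -[x]scale1r; apply: gsP. Qed.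

Lemma gsZ M (W : gradedSub M) c x : W x -> W (c *: x).
Proof. by move=> Wx; rewrite -[_ *: _]addr0; apply: gsP (gs0 W). Qed.

Lemma gsB M (W : gradedSub M) x y : W x -> W y -> W (x - y).
Proof. by move=> Wx Wy; rewrite -scaleN1r; apply: gsD (gsZ _ Wy). Qed.

Section SubModule.
Variables (M : gradedModule) (W : gradedSub M).

Definition gs_pred : {pred M} := mem (gs_set W : set M).

HB.instance Definition _ := GRing.isSubmodClosed.Build coxRing M gs_pred
  (gs_submod W).

Record subCarrier := SubCarrier { sub_val : M; _ : sub_val \in gs_pred }.

HB.instance Definition _ := [isSub of subCarrier for sub_val].
HB.instance Definition _ := [Choice of subCarrier by <:].
HB.instance Definition _ := [SubChoice_isSubLmodule of subCarrier by <:].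

Definition sub_comp (a : Z) : set subCarrier := [set x | gm_comp a (sub_val x)].

Lemma sub_valP (x : subCarrier) : W (sub_val x).
Proof. by case: x => x /= /set_mem. Qed.

Fact sub_comp0 a : sub_comp a 0.
Proof. exact: gm_comp0. Qed.

Fact sub_compB a x y : sub_comp a x -> sub_comp a y -> sub_comp a (x - y).
Proof. exact: gm_compB. Qed.

Fact sub_scale a b s x :
  cox_degree b s -> sub_comp a x -> sub_comp (a + b) (s *: x).
Proof. exact: gm_scale. Qed.

Lemma sub_val_sum (s : seq Z) (f : Z -> subCarrier) :
  sub_val (\sum_(a <- s) f a) = \sum_(a <- s) sub_val (f a).
Proof. exact: (raddf_sum (val : subCarrier -> M)). Qed.

Fact sub_dec x : exists (s : seq Z) (f : Z -> subCarrier),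
  [/\ uniq s, (forall a, sub_comp a (f a)) & x = \sum_(a <- s) f a].
Proof.
have [s [f [us cf xE]]] := gm_dec (sub_val x).
have Wf a : a \in s -> W (f a).
  by apply: (gs_homog us cf); rewrite -xE; apply: sub_valP.
exists s, (fun a => insubd 0 (f a)); split=> //.
  move=> a; rewrite /sub_comp /= /insubd.
  by case: insubP => [u _ ->|_] //=; apply: gm_comp0.
apply: val_inj; rewrite [RHS]sub_val_sum /= xE.
rewrite !big_seq; apply: eq_bigr => a sa.
by rewrite insubdK //; apply/mem_set/Wf.
Qed.

Fact sub_indep (s : seq Z) (f : Z -> subCarrier) :
  uniq s -> (forall a, sub_comp a (f a)) -> \sum_(a <- s) f a = 0 ->
  forall a, a \in s -> f a = 0.
Proof.
move=> us cf sf0 a sa; apply: val_inj => /=.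
apply: (@gm_indep M s (fun a => sub_val (f a)) us cf _ a sa).
by rewrite -sub_val_sum sf0.
Qed.

Definition subModule : gradedModule := @GradedModule subCarrier
  sub_comp sub_comp0 sub_compB sub_scale sub_dec sub_indep.

End SubModule.

Section QuotModule.
Variables (M : gradedModule) (W : gradedSub M).
Local Open Scope quotient_scope.

Notation Q := (@Quotient.quot M (gs_pred W)).

Definition quotCarrier := Q.
HB.instance Definition _ := GRing.Zmodule.on quotCarrier.

Definition quot_pi (x : M) : quotCarrier := \pi_Q x.

Lemma quot_piE x y : (quot_pi x = quot_pi y) <-> W (x - y).
Proof.
split=> [h|Wxy].
  by apply: set_mem; have /eqP := h; rewrite -Quotient.idealrBE.
by apply/eqP; rewrite -Quotient.idealrBE; apply: mem_set.
Qed.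

Lemma quot_piD x y : quot_pi (x + y) = quot_pi x + quot_pi y.
Proof. exact: (raddfD (\pi_Q)). Qed.

Lemma quot_piB x y : quot_pi (x - y) = quot_pi x - quot_pi y.
Proof. exact: (raddfB (\pi_Q)). Qed.

Lemma quot_pi0 : quot_pi 0 = 0.
Proof. exact: (raddf0 (\pi_Q)). Qed.

Definition quot_scale (c : coxRing) (u : quotCarrier) : quotCarrier :=
  quot_pi (c *: repr (u : Q)).

Lemma quot_piZ c x : quot_scale c (quot_pi x) = quot_pi (c *: x).
Proof.
apply/quot_piE; rewrite -scalerBr; apply: gsZ; apply/quot_piE.
exact: (reprK (quot_pi x : Q)).
Qed.

Lemma quot_surj (u : quotCarrier) : exists x, u = quot_pi x.
Proof. by exists (repr (u : Q)); rewrite /quot_pi reprK. Qed.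

Fact quot_scaleA a b u : quot_scale a (quot_scale b u) = quot_scale (a * b) u.
Proof. by have [x ->] := quot_surj u; rewrite !quot_piZ scalerA. Qed.

Fact quot_scale1 : left_id 1 quot_scale.
Proof. by move=> u; have [x ->] := quot_surj u; rewrite quot_piZ scale1r. Qed.

Fact quot_scaleDr : right_distributive quot_scale +%R.
Proof.
move=> a u v; have [x ->] := quot_surj u; have [y ->] := quot_surj v.
by rewrite -quot_piD !quot_piZ scalerDr quot_piD.
Qed.

Fact quot_scaleDl u : {morph quot_scale^~ u : a b / a + b}.
Proof.
by move=> a b; have [x ->] := quot_surj u; rewrite !quot_piZ scalerDl quot_piD.
Qed.

HB.instance Definition _ := GRing.Zmodule_isLmodule.Build coxRing quotCarrier
  quot_scaleA quot_scale1 quot_scaleDr quot_scaleDl.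

Definition quot_comp (a : Z) : set quotCarrier := quot_pi @` @gm_comp M a.

Fact quot_comp0 a : quot_comp a 0.
Proof. by exists 0; [apply: gm_comp0 | apply: quot_pi0]. Qed.

Fact quot_compB a u v : quot_comp a u -> quot_comp a v -> quot_comp a (u - v).
Proof.
move=> [x cx <-] [y cy <-]; exists (x - y); last exact: quot_piB.
exact: gm_compB.
Qed.

Fact quot_compZ a b s u :
  cox_degree b s -> quot_comp a u -> quot_comp (a + b) (s *: u).
Proof.
move=> ds [x cx <-]; exists (s *: x); first exact: gm_scale.
by rewrite -quot_piZ.
Qed.

Lemma quot_pi_sum (s : seq Z) (f : Z -> M) :
  quot_pi (\sum_(a <- s) f a) = \sum_(a <- s) quot_pi (f a).
Proof. exact: (big_morph quot_pi quot_piD quot_pi0). Qed.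

Fact quot_dec u : exists (s : seq Z) (f : Z -> quotCarrier),
  [/\ uniq s, (forall a, quot_comp a (f a)) & u = \sum_(a <- s) f a].
Proof.
have [x ->] := quot_surj u; have [s [f [us cf ->]]] := gm_dec x.
exists s, (fun a => quot_pi (f a)); split=> //; last exact: quot_pi_sum.
by move=> a; exists (f a).
Qed.

Fact quot_indep (s : seq Z) (f : Z -> quotCarrier) :
  uniq s -> (forall a, quot_comp a (f a)) -> \sum_(a <- s) f a = 0 ->
  forall a, a \in s -> f a = 0.
Proof.
move=> us cf sf0 a sa.
have /choice[g gP] : forall a, exists x, gm_comp a x /\ quot_pi x = f a.
  by move=> b; have [x] := cf b; exists x.
rewrite -(gP a).2 -quot_pi0; apply/quot_piE; rewrite subr0.
apply: (gs_homog us (fun b => (gP b).1) _ sa).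
rewrite -[X in gs_set W X]subr0; apply/quot_piE; rewrite quot_pi0 quot_pi_sum.
by rewrite -[RHS]sf0; apply: eq_bigr => b _; case: (gP b).
Qed.

Definition quotModule : gradedModule := @GradedModule quotCarrier
  quot_comp quot_comp0 quot_compB quot_compZ quot_dec quot_indep.

End QuotModule.

Section Kernels.
Variables (M N : gradedModule) (f : gradedHom M N).

Fact ker_submod : submod_closed (mem [set x : M | f x = 0]).
Proof.
split; first by apply: mem_set => /=; rewrite linear0.
move=> c x y /set_mem /= fx /set_mem /= fy; apply: mem_set => /=.
by rewrite linearP fx fy scaler0 addr0.
Qed.

Fact ker_homog (s : seq Z) (g : Z -> M) :
  uniq s -> (forall a, gm_comp a (g a)) ->
  [set x : M | f x = 0] (\sum_(a <- s) g a) ->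
  forall a, a \in s -> [set x : M | f x = 0] (g a).
Proof.
move=> us cg /=; rewrite linear_sum /= => /gm_indep; apply=> // a.
exact: gh_degree.
Qed.

Definition kernel : gradedSub M := GradedSub ker_submod ker_homog.

Fact im_submod : submod_closed (mem (range f)).
Proof.
split; first by apply: mem_set; exists 0; rewrite ?linear0.
move=> c _ _ /set_mem[x _ <-] /set_mem[y _ <-]; apply: mem_set.
by exists (c *: x + y); rewrite ?linearP.
Qed.

Fact im_homog (s : seq Z) (g : Z -> N) :
  uniq s -> (forall a, gm_comp a (g a)) -> range f (\sum_(a <- s) g a) ->
  forall a, a \in s -> range f (g a).
Proof.
move=> us cg [x _ fxE] a sa.
have [t [h [ut ch xE]]] := gm_dec x.
pose h' b := if b \in t then h b else 0; pose g' b := if b \in s then g b else 0.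
pose u := undup (s ++ t).
have widen (K : zmodType) (r : seq Z) (F : Z -> K) : uniq r ->
    {subset r <= u} ->
    \sum_(b <- r) F b = \sum_(b <- u) (if b \in r then F b else 0).
  move=> ur ru; rewrite -big_mkcond /= -[RHS]big_filter; apply: perm_big.
  apply: uniq_perm => //; first by rewrite filter_uniq ?undup_uniq.
  by move=> b; rewrite mem_filter andb_idr // => /ru.
have su : {subset s <= u} by move=> b bs; rewrite mem_undup mem_cat bs.
have tu : {subset t <= u} by move=> b bt; rewrite mem_undup mem_cat bt orbT.
have h'c b : gm_comp b (h' b) by rewrite /h'; case: ifP => _ //; apply: gm_comp0.
have g'c b : gm_comp b (g' b) by rewrite /g'; case: ifP => _ //; apply: gm_comp0.
have z : \sum_(b <- u) (g' b - f (h' b)) = 0.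
  apply/eqP; rewrite sumrB subr_eq0 -(widen _ s g) // -fxE xE (widen _ t) //.
  rewrite linear_sum; apply/eqP; apply: eq_bigr => b _ /=.
  by rewrite /h'; case: ifP.
have zc b : gm_comp b (g' b - f (h' b)).
  by apply: gm_compB => //; apply: gh_degree.
have /eqP := gm_indep (undup_uniq _) zc z (su _ sa).
by rewrite /g' sa subr_eq0 => /eqP gE; exists (h' a).
Qed.

Definition image_sub : gradedSub N := GradedSub im_submod im_homog.

End Kernels.

Section RestrictHom.
Variables (M N : gradedModule) (f : gradedHom M N).
Variables (V : gradedSub M) (W : gradedSub N).
Hypothesis fVW : forall x, V x -> W (f x).

Fact restr_subproof (x : subModule V) : f (sub_val x) \in gs_pred W.
Proof. by apply: mem_set; apply: fVW; apply: sub_valP. Qed.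

Definition restr_fun (x : subModule V) : subModule W :=
  SubCarrier (restr_subproof x).

Fact restr_linear : linear restr_fun.
Proof. by move=> c x y; apply: val_inj; rewrite /= linearP. Qed.

HB.instance Definition _ :=
  GRing.isLinear.Build coxRing (subModule V) (subModule W) _ restr_fun
    restr_linear.

Fact restr_degree a (x : subModule V) :
  gm_comp a x -> gm_comp a (restr_fun x).
Proof. exact: (@gh_degree _ _ f a (sub_val x)). Qed.

Definition restr_hom : gradedHom (subModule V) (subModule W) :=
  @GradedHom (subModule V) (subModule W) restr_fun restr_degree.

End RestrictHom.

Fact zero_submod (M : gradedModule) : submod_closed (mem [set 0 : M]).
Proof.
split; first exact: mem_set.
by move=> c x y /set_mem -> /set_mem ->; apply: mem_set; rewrite scaler0 addr0.
Qed.

Fact zero_homog (M : gradedModule) (s : seq Z) (f : Z -> M) :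
  uniq s -> (forall a, gm_comp a (f a)) -> [set 0 : M] (\sum_(a <- s) f a) ->
  forall a, a \in s -> [set 0 : M] (f a).
Proof. by move=> us cf /= h a sa; apply: (gm_indep us cf h sa). Qed.

Definition zero_sub (M : gradedModule) : gradedSub M :=
  GradedSub (@zero_submod M) (@zero_homog M).

Section Preimage.
Variables (M : gradedModule) (V W : gradedSub M).

Fact trace_submod : submod_closed (mem [set x : subModule V | W (sub_val x)]).
Proof.
split; first by apply: mem_set; apply: gs0.
by move=> c x y /set_mem Wx /set_mem Wy; apply: mem_set; apply: gsP.
Qed.

Fact trace_homog (s : seq Z) (f : Z -> subModule V) :
  uniq s -> (forall a, gm_comp a (f a)) ->
  [set x : subModule V | W (sub_val x)] (\sum_(a <- s) f a) ->
  forall a, a \in s -> [set x : subModule V | W (sub_val x)] (f a).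
Proof.
move=> us cf /= h a sa.
apply: (@gs_homog _ W s (fun b => sub_val (f b)) us cf _ a sa).
by rewrite -sub_val_sum.
Qed.

(* The submodule W `&` V of V. *)
Definition trace_sub : gradedSub (subModule V) :=
  GradedSub trace_submod trace_homog.

End Preimage.

(* Zs / (Bs `&` Zs), which is Zs / Bs when Bs is contained in Zs, as is the   *)
(* case for the coboundaries and cocycles of a complex.                      *)
Definition subquotient (M : gradedModule) (Zs Bs : gradedSub M) : gradedModule :=
  quotModule (trace_sub Zs Bs).

Definition is_ideal (J : set coxRing) :=
  [/\ J 0, (forall x y, J x -> J y -> J (x + y))
    & forall c x, J x -> J (c * x)].

Definition ideal_gen (G : set coxRing) : set coxRing := smallest is_ideal G.

Fixpoint ideal_pow (B : set coxRing) (m : nat) : set coxRing :=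
  if m is m'.+1 then
    ideal_gen [set z | exists b c, [/\ B b, ideal_pow B m' c & z = b * c]]
  else setT.

Record homogeneousIdeal := HomogeneousIdeal {
  hi_gens : set coxRing;
  hi_homog : forall g, hi_gens g -> exists b, cox_degree b g }.

Definition hi_set (B : homogeneousIdeal) : set coxRing := ideal_gen (hi_gens B).


Fact ideal_genP G : is_ideal (ideal_gen G).
Proof.
split; first by move=> J [[]].
- by move=> x y Gx Gy J [JI JG]; have [_ h _] := JI; apply: h; [apply: Gx|apply: Gy].
- by move=> c x Gx J [JI JG]; have [_ _ h] := JI; apply: h; apply: Gx.
Qed.

Fact ideal_powP B m : is_ideal (ideal_pow B m).
Proof. by case: m => [|m]; [split|apply: ideal_genP]. Qed.

Fact ideal_pow_le B m l : (m <= l)%N -> ideal_pow B l `<=` ideal_pow B m.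
Proof.
elim: l m => [|l IH] [|m] //= ml; apply: smallest_sub; first exact: ideal_genP.
move=> _ [b [c [Bb Bc ->]]] J [JI JG]; apply: JG; exists b, c; split=> //.
exact: IH Bc.
Qed.

Section Torsion.
Variables (B : homogeneousIdeal) (M : gradedModule).

Definition torsion_set : set M :=
  [set x | exists m, forall b, ideal_pow (hi_set B) m b -> b *: x = 0].

Fact torsion_submod : submod_closed (mem torsion_set).
Proof.
split; first by apply: mem_set; exists 0%N => b _; rewrite scaler0.
move=> c x y /set_mem[m xm] /set_mem[l yl]; apply: mem_set.
exists (maxn m l) => b Bb; rewrite scalerDr scalerA mulrC -scalerA.
rewrite xm ?yl ?scaler0 ?addr0 //.
  by apply: ideal_pow_le Bb; rewrite leq_maxr.
by apply: ideal_pow_le Bb; rewrite leq_maxl.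
Qed.

Fact torsion_homog (s : seq Z) (f : Z -> M) :
  uniq s -> (forall a, gm_comp a (f a)) -> torsion_set (\sum_(a <- s) f a) ->
  forall a, a \in s -> torsion_set (f a).
Proof.
move=> us cf [m xm] a sa; exists m.
elim: m s f us cf xm a sa => [|m IH] s f us cf xm a sa b.
  move=> _; rewrite (gm_indep us cf _ sa) ?scaler0 //.
  by rewrite -[LHS]scale1r; apply: xm.
pose J := [set x : coxRing | x *: f a = 0].
have JI : is_ideal J.
  rewrite /J; split=> [|x y /= xf yf|c x /= xf] /=; first by rewrite scale0r.
    by rewrite scalerDl xf yf addr0.
  by rewrite -scalerA xf scaler0.
suff BJ : ideal_pow (hi_set B) m.+1 `<=` J by apply: BJ.
apply: smallest_sub JI _ => _ [{}b [c [Bb Bc ->]]] /=.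
pose K := [set x : coxRing | forall c, ideal_pow (hi_set B) m c ->
  (c * x) *: f a = 0].
have KI : is_ideal K.
  rewrite /K; split=> [|x y /= xf yf|x y /= yf] /=.
  - by move=> c' _; rewrite mulr0 scale0r.
  - by move=> c' Bc'; rewrite mulrDr scalerDl xf ?yf ?addr0.
  - by move=> c' Bc'; rewrite mulrCA -scalerA yf ?scaler0.
suff BK : hi_set B `<=` K by rewrite /J /= mulrC; apply: BK.
apply: smallest_sub KI _ => g Gg; have [be dg] := hi_homog Gg.
pose f' z := g *: f (z - be).
move=> c' Bc'; rewrite -scalerA.
have -> : g *: f a = f' (a + be) by rewrite /f' addrK.
apply: (IH [seq b + be | b <- s] f') Bc'.
- by rewrite map_inj_uniq //; apply: addIr.
- by move=> z; have := gm_scale dg (cf (z - be)); rewrite subrK.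
- move=> z Bz; rewrite big_map.
  rewrite (eq_bigr (fun i => g *: f i)) => [|i _]; last by rewrite /f' addrK.
  rewrite -scaler_sumr scalerA mulrC; apply: xm => J' [_ JG']; apply: JG'.
  by exists g, z; split=> // J'' [_]; apply.
- by apply: map_f.
Qed.

Definition torsion : gradedSub M := GradedSub torsion_submod torsion_homog.

End Torsion.

Fact torsion_hom_subproof (B : homogeneousIdeal) (M N : gradedModule)
  (f : gradedHom M N) x : torsion B M x -> torsion B N (f x).
Proof. by case=> m xm; exists m => b Bb; rewrite -linearZ xm ?linear0. Qed.

(* The functor H^0_B on graded modules: elements killed by a power of B. *)
Definition Gamma (B : homogeneousIdeal) (M : gradedModule) : gradedModule :=
  subModule (torsion B M).

Definition Gamma_hom (B : homogeneousIdeal) (M N : gradedModule)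
    (f : gradedHom M N) : gradedHom (Gamma B M) (Gamma B N) :=
  restr_hom (@torsion_hom_subproof B M N f).

Definition graded_injective (E : gradedModule) :=
  forall (M N : gradedModule) (i : gradedHom M N) (f : gradedHom M E),
    injective i -> exists g : gradedHom N E, forall x, g (i x) = f x.

Record injectiveResolution (P : gradedModule) := InjectiveResolution {
  ir_obj :> nat -> gradedModule;
  ir_aug : gradedHom P (ir_obj 0);
  ir_diff : forall i, gradedHom (ir_obj i) (ir_obj i.+1);
  ir_injective : forall i, graded_injective (ir_obj i);
  ir_aug_inj : injective ir_aug;
  ir_exact0 : forall x, ir_diff 0 x = 0 <-> range ir_aug x;
  ir_exact : forall i x, ir_diff i.+1 x = 0 <-> range (ir_diff i) x }.

(* The right derived functors of Gamma B on the category of graded modules.   *)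
(* As S is noetherian and B is homogeneous, graded injectives are acyclic for *)
(* the ungraded torsion functor, so that this is the usual local cohomology   *)
(* with its induced grading.                                                  *)
Definition coboundaries (B : homogeneousIdeal) (P : gradedModule)
    (E : injectiveResolution P) (i : nat) : gradedSub (Gamma B (E i)) :=
  match i with
  | 0 => zero_sub (Gamma B (E 0%N))
  | i'.+1 => image_sub (Gamma_hom B (ir_diff E i'))
  end.

Definition local_cohomology (B : homogeneousIdeal) (P : gradedModule)
    (E : injectiveResolution P) (i : nat) : gradedModule :=
  subquotient (kernel (Gamma_hom B (ir_diff E i))) (coboundaries B E i).

End CoxRing.

Section IrrelevantIdeal.
Variables (R : realType) (k : closedFieldType) (n d e : nat).
Variables (Delta : fan R n) (tau : 'I_d -> set 'rV[R]_n).

Definition cone_monomial (sigma : set 'rV[R]_n) : coxRing k d e :=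
  \prod_(i < d | ~~ `[< tau i `<=` sigma >]) coxvar k (lshift e i).

Definition irrelevant_gens : set (coxRing k d e) :=
  [set cone_monomial sigma | sigma in maximal_cone Delta].

Fact irrelevant_homog g : irrelevant_gens g -> exists b, cox_degree b g.
Proof.
case=> sigma _ <-; rewrite /cone_monomial.
elim/big_ind : _ => [|x y [a xa] [b yb]|i _].
- by exists 0; apply: cox_degree1.
- by exists (a + b); apply: cox_degreeM.
- by exists (delta_mx 0 (lshift e i)); apply: cox_degree_var.
Qed.

Definition irrelevant_ideal : homogeneousIdeal k d e :=
  HomogeneousIdeal irrelevant_homog.

End IrrelevantIdeal.

(* Main.v *)
Require Import Defs.
From HB Require Import structures.
From mathcomp Require Import all_boot all_order all_algebra.
From mathcomp Require Import boolp classical_sets functions reals.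
From mathcomp Require Import mpoly.

(* Fix a variable Y = Y_j with j <= d and an integer c outside I. Two facts   *)
(* about a graded injective E carry the proof. First, multiplication by Y is  *)
(* surjective from degree a to degree a + f_j, even on B-torsion elements: E  *)
(* is a direct factor of the module obtained from E by adjoining a quotient   *)
(* y / Y of each of its elements, and y / Y is B-torsion when y is. Secondly, *)
(* call slice of a module the part of the annihilator of Y in the degrees     *)
(* with j-th entry c. When P is I-homogeneous, the slices of an injective     *)
(* resolution of P form an exact complex of injective objects among the       *)
(* modules killed by Y and living in those degrees; it is therefore           *)
(* contractible, and remains exact after taking torsion. A diagram chase      *)
(* gives the bijectivity of Y on the cohomology of the torsion subcomplex.    *)
(* Invertible variables act bijectively on every graded module.               *)

Set Implicit Arguments.
Unset Strict Implicit.
Unset Printing Implicit Defensive.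

Import Order.TTheory GRing.Theory Num.Theory.
Local Open Scope classical_set_scope.
Local Open Scope ring_scope.

(** An invertible variable acts bijectively on every graded module, so let Y = Y_j with j <= d and
    let c be an entry outside I. Augment the resolution to the exact complex 0 -> P -> E^0 -> E^1 ->
    ... In the degrees with j-th entry c, multiplication by Y is surjective on each term: on P by
    homogeneity, on the injectives by [injective_divisible]. The slices, its kernels there, thus
    form the kernel of a surjection of exact complexes, and so are exact ([slice_exact]). The slice
    of P vanishes, since Y is injective there. Injectivity of the terms then yields, degree by
    degree, linear maps h with D h x = x on slice cocycles ([slice_contraction]). Such an h
    preserves everything that linearity sees: h x has the degree of x and is killed by whatever
    kills x, so it is torsion when x is. Hence a torsion cocycle of a slice bounds a torsion element
    killed by Y ([slice_boundary]). Since Y can also be divided out of torsion elements of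
    injectives, bijectivity of Y on cohomology follows: [torsion_boundary_reg] gives injectivity,
    [torsion_cycle_divisible] surjectivity. *)

Section CoxRingTheory.
Variables (k : closedFieldType) (d e : nat).
Notation S := (coxRing k d e).
Notation MP := {mpoly k[d + e]}.
Notation Z := 'rV[int]_(d + e).
Notation Y := (coxvar k).
Implicit Types (r s t : S) (a b : Z).

(** * Arithmetic and grading of the homogeneous coordinate ring *)

Lemma cox_valD r s : cox_val (r + s) = cox_val r + cox_val s.
Proof. exact: (raddfD (val : S -> _)). Qed.

Lemma cox_valB r s : cox_val (r - s) = cox_val r - cox_val s.
Proof. exact: (raddfB (val : S -> _)). Qed.

Lemma cox_valM r s : cox_val (r * s) = cox_val r * cox_val s.
Proof. by rewrite [LHS](rmorphM (val : S -> _)). Qed.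

Lemma cox_val_inj : injective (@cox_val k d e).
Proof. exact: val_inj. Qed.

Lemma cox_val_prod (J : Type) (l : seq J) (F : J -> S) :
  cox_val (\prod_(i <- l) F i) = \prod_(i <- l) cox_val (F i).
Proof. exact: (rmorph_prod (val : S -> _)). Qed.

Lemma cox_valX r m : cox_val (r ^+ m) = cox_val r ^+ m.
Proof. exact: (rmorphXn (val : S -> _)). Qed.

Lemma coxM_eq0 r s : r * s = 0 -> r = 0 \/ s = 0.
Proof.
move=> /(congr1 (@cox_val k d e))/eqP; rewrite cox_valM /= mulf_eq0.
by case/orP => /eqP h; [left | right]; apply: cox_val_inj.
Qed.

Lemma coxvarX_neq0 i m : Y i ^+ m <> 0 :> S.
Proof.
move=> /(congr1 (@cox_val k d e)); rewrite cox_valX /=; apply/eqP.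
by rewrite expf_neq0 // tofrac_eq0 mpolyX_neq0.
Qed.

Lemma coxvar_mulI i : injective (fun r : S => Y i * r).
Proof.
move=> r s /= YrYs; have /coxM_eq0[Y0|/eqP] : Y i * (r - s) = 0.
- by rewrite mulrBr YrYs subrr.
- by have := @coxvarX_neq0 i 1; rewrite expr1.
- by rewrite subr_eq0 => /eqP.
Qed.

Lemma coxvar_degree_div i b s :
  cox_degree b (Y i * s) -> cox_degree (b - delta_mx 0 i) s.
Proof.
have X0 l : tofrac ('X_l : MP) != 0 by rewrite tofrac_eq0 mpolyX_neq0.
case=> c; rewrite cox_valM /= => sE; exists c; apply: (mulfI (X0 i)).
rewrite sE mulrCA; congr (_ * _).
rewrite (bigD1 i) //= [in RHS](bigD1 i) //= mulrA; congr (_ * _).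
  rewrite !mxE !eqxx -[X in _ = X * _]expr1z -expfzDr //.
  by rewrite addrCA subrr addr0.
by apply: eq_bigr => l /negbTE li; rewrite !mxE li andbF subr0.
Qed.

Lemma cox_degree0 b : cox_degree b (0 : S).
Proof. by exists 0; rewrite mpolyC0 tofrac0 mul0r. Qed.

Lemma coxvar_shift_inv (i : 'I_e) :
  exists2 u : S, Y (rshift d i) * u = 1
               & cox_degree (- delta_mx 0 (rshift d i)) u.
Proof.
pose q : MP := \prod_(l < e | l != i) 'X_(rshift d l).
have uP : (tofrac ('X_(rshift d i) : MP))^-1 \in @cox_pred k d e.
  apply/asboolP; exists q, 1%N; rewrite expr1 /laurent_den (bigD1 i) //=.
  rewrite /q rmorph_prod /= invfM mulrCA divff ?mulr1 //.
  by apply/prodf_neq0 => l _; rewrite tofrac_eq0 mpolyX_neq0.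
have YV : Y (rshift d i) * CoxRing uP = 1 :> S.
  by apply: cox_val_inj; rewrite cox_valM /= divff // tofrac_eq0 mpolyX_neq0.
exists (CoxRing uP) => //.
by rewrite -[- _]add0r; apply: coxvar_degree_div; rewrite YV; apply: cox_degree1.
Qed.

(** Expanding the numerator of a fraction into monomials, over a fixed denominator, exhibits it as a
    sum of homogeneous elements. *)
Lemma cox_homog_ind (J : S -> Prop) :
  J 0 -> (forall r s, J r -> J s -> J (r + s)) ->
  (forall b r, cox_degree b r -> J r) -> forall r, J r.
Proof.
move=> J0 JD Jh r; have /asboolP[p [m rE]] := valP r.
have cP (q : MP) : tofrac q / laurent_den k d e ^+ m \in @cox_pred k d e.
  by apply/asboolP; exists q, m.
have -> : r = CoxRing (cP p) by apply: cox_val_inj.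
have X0 l : tofrac ('X_l : MP) != 0 by rewrite tofrac_eq0 mpolyX_neq0.
elim/mpolyind: p {rE} => [|c mon p _ _ IH].
  rewrite (_ : CoxRing _ = 0) //; apply: cox_val_inj.
  by rewrite /= tofrac0 mul0r.
rewrite (_ : CoxRing _ = CoxRing (cP (c *: 'X_[mon])) + CoxRing (cP p)); last first.
  by apply: cox_val_inj; rewrite cox_valD /= tofracD mulrDl.
(* Dividing by the m-th power of the product of the invertible variables lowers their exponents by
   m. *)
apply: JD => //; pose w : Z := \row_(l < d + e)
  (if fintype.split l is inr _ then (mon l)%:Z - m%:Z else (mon l)%:Z).
apply: (Jh w); exists c; rewrite /= -mul_mpolyC tofracM -mulrA; congr (_ * _).
rewrite mpolyXE_id rmorph_prod /= /laurent_den -prodrXl.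
rewrite !big_split_ord /= -mulrA -prodf_div; congr (_ * _).
  apply: eq_bigr => l _; rewrite mxE rmorphXn.
  by rewrite (unsplitK (inl l) : fintype.split (lshift e l) = _).
apply: eq_bigr => l _; rewrite mxE rmorphXn /=.
rewrite (unsplitK (inr l) : fintype.split (rshift d l) = _).
by rewrite expfzDr // -exprnN.
Qed.

(** * Setting a variable to zero, and the associated difference quotient *)

Section KillVariable.
Variable j0 : 'I_d.
Notation j := (lshift e j0).

Definition mpoly_kill (p : MP) : MP :=
  p \mPo [tuple if i == j then 0 else 'X_i | i < d + e].

Lemma mpoly_killX i : mpoly_kill 'X_i = if i == j then 0 else 'X_i.
Proof. by rewrite /mpoly_kill comp_mpolyXU -tnth_nth tnth_mktuple. Qed.

Notation denp := (\prod_(i < e) 'X_(rshift d i) : MP).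

Lemma laurent_denE m : laurent_den k d e ^+ m = tofrac (denp ^+ m).
Proof. by rewrite /laurent_den rmorphXn rmorph_prod. Qed.

Lemma laurent_fracB (p q : MP) m l :
  tofrac p / laurent_den k d e ^+ m - tofrac q / laurent_den k d e ^+ l =
  tofrac (p * denp ^+ l - q * denp ^+ m) / laurent_den k d e ^+ (m + l).
Proof.
rewrite -mulNr addf_div ?expf_neq0 ?laurent_den_neq0 // -exprD mulNr.
by rewrite [in RHS]rmorphB !rmorphM /= -!laurent_denE.
Qed.

Lemma mpoly_kill_den m : mpoly_kill (denp ^+ m) = denp ^+ m.
Proof.
rewrite /mpoly_kill rmorphXn rmorph_prod /=; congr (_ ^+ _).
apply: eq_bigr => i _; rewrite -/(mpoly_kill _) mpoly_killX ifN //.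
by rewrite eq_sym eq_lrshift.
Qed.

Lemma cox_repr r :
  {pm : MP * nat | cox_val r = tofrac pm.1 / laurent_den k d e ^+ pm.2}.
Proof.
by apply: cid; have /asboolP[p [m rE]] := valP r; exists (p, m).
Qed.

Lemma cox_kill_subproof r : tofrac (mpoly_kill (sval (cox_repr r)).1) /
  laurent_den k d e ^+ (sval (cox_repr r)).2 \in @cox_pred k d e.
Proof. by apply/asboolP; eexists _, _. Qed.

Definition cox_kill r : S := CoxRing (cox_kill_subproof r).

(** The result does not depend on the chosen fraction: denominators involve only the invertible
    variables, so the substitution fixes them and respects cross-multiplied identities. *)
Lemma cox_killE r p m : cox_val r = tofrac p / laurent_den k d e ^+ m ->
  cox_val (cox_kill r) = tofrac (mpoly_kill p) / laurent_den k d e ^+ m.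
Proof.
have D0 l : laurent_den k d e ^+ l != 0 by rewrite expf_neq0 ?laurent_den_neq0.
have denK m' l' (u v : MP) : tofrac u / laurent_den k d e ^+ m' =
    tofrac v / laurent_den k d e ^+ l' <-> u * denp ^+ l' = v * denp ^+ m'.
  split=> [/eqP|uv]; last apply/eqP; rewrite eqr_div ?D0 //.
    by rewrite !laurent_denE -!rmorphM tofrac_eq => /eqP.
  by rewrite !laurent_denE -!rmorphM tofrac_eq uv.
move=> rE; rewrite /cox_kill /=; case: (cox_repr r) => -[q l] /=; rewrite rE.
move=> /denK pq; apply/denK.
move: (congr1 mpoly_kill pq); rewrite /mpoly_kill !rmorphM /= -!/(mpoly_kill _).
by rewrite !mpoly_kill_den => ->.
Qed.

Fact cox_kill_is_zmod_morphism : zmod_morphism cox_kill.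
Proof.
move=> r s; have [[p m] rE] := cox_repr r; have [[q l] sE] := cox_repr s.
rewrite /= in rE sE.
have rsE : cox_val (r - s) =
    tofrac (p * denp ^+ l - q * denp ^+ m) / laurent_den k d e ^+ (m + l).
  by rewrite cox_valB rE sE laurent_fracB.
apply: cox_val_inj; rewrite (cox_killE rsE).
rewrite cox_valB (cox_killE rE) (cox_killE sE).
by rewrite laurent_fracB /mpoly_kill rmorphB !rmorphM /=
  -!/(mpoly_kill _) !mpoly_kill_den.
Qed.

Fact cox_kill_is_monoid_morphism : monoid_morphism cox_kill.
Proof.
split=> [|r s].
  have E1 : cox_val (1 : S) = tofrac 1 / laurent_den k d e ^+ 0.
    by rewrite tofrac1 expr0 divr1.
  apply: cox_val_inj; rewrite (cox_killE E1) E1.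
  by rewrite /mpoly_kill rmorph1.
have [[p m] rE] := cox_repr r; have [[q l] sE] := cox_repr s.
rewrite /= in rE sE.
have rsE : cox_val (r * s) = tofrac (p * q) / laurent_den k d e ^+ (m + l).
  by rewrite cox_valM rE sE rmorphM /= exprD mulf_div.
apply: cox_val_inj; rewrite (cox_killE rsE) cox_valM (cox_killE rE) (cox_killE sE).
by rewrite /mpoly_kill !rmorphM /= exprD mulf_div.
Qed.

HB.instance Definition _ :=
  GRing.isZmodMorphism.Build S S cox_kill cox_kill_is_zmod_morphism.
HB.instance Definition _ :=
  GRing.isMonoidMorphism.Build S S cox_kill cox_kill_is_monoid_morphism.

Lemma cox_kill_var i : cox_kill (Y i) = if i == j then 0 else Y i.
Proof.
have E : cox_val (Y i : S) = tofrac 'X_i / laurent_den k d e ^+ 0.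
  by rewrite expr0 divr1.
apply: cox_val_inj; rewrite (cox_killE E) mpoly_killX.
by case: ifP => _; rewrite expr0 divr1 // tofrac0.
Qed.

Lemma cox_kill_homog b r : cox_degree b r ->
  cox_kill r = if b 0 j == 0 then r else 0.
Proof.
have X0 l : tofrac ('X_l : MP) != 0 by rewrite tofrac_eq0 mpolyX_neq0.
case=> c rE.
have cP : tofrac (c%:MP : MP) \in @cox_pred k d e.
  by apply/asboolP; exists c%:MP, 0%N; rewrite expr0 divr1.
have kc : cox_kill (CoxRing cP) = CoxRing cP.
  have E : cox_val (CoxRing cP) = tofrac (c%:MP : MP) / laurent_den k d e ^+ 0.
    by rewrite expr0 divr1.
  by apply: cox_val_inj; rewrite (cox_killE E) expr0 divr1 /mpoly_kill comp_mpolyC.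
pose np (z : int) : nat := if (0 <= z)%R then 0%N else `|z|%N.
pose pp (z : int) : nat := if (0 <= z)%R then `|z|%N else 0%N.
pose A : S := \prod_(i < d + e | i != j) Y i ^+ np (b 0 i).
pose A' : S := \prod_(i < d + e | i != j) Y i ^+ pp (b 0 i).
have kA (f : 'I_(d + e) -> nat) (B : S := \prod_(i < d + e | i != j) Y i ^+ f i) :
    cox_kill B = B.
  rewrite rmorph_prod; apply: eq_bigr => i /negbTE ij.
  by rewrite rmorphXn /= cox_kill_var ij.
have A0 : A <> 0.
  rewrite /A; elim/big_ind: _ => [|x y x0 y0 /coxM_eq0[]|i _] //.
    by apply/eqP; apply: oner_neq0.
  exact: coxvarX_neq0.
(* Moving negative exponents to the left gives an identity without inverses, to which [cox_kill]
   applies. If the j-th exponent is positive, the right side dies; if negative, the left side dies,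
   which forces the constant, hence r, to vanish. *)
have key : r * (Y j ^+ np (b 0 j) * A) = CoxRing cP * (Y j ^+ pp (b 0 j) * A').
  apply: cox_val_inj; rewrite !cox_valM rE /= -mulrA; congr (_ * _).
  have prodE (f : 'I_(d + e) -> nat) :
      Y j ^+ f j * \prod_(i < d + e | i != j) Y i ^+ f i
      = \prod_(i < d + e) Y i ^+ f i :> S by rewrite [RHS](bigD1 j).
  rewrite -!cox_valM (prodE (fun i => np (b 0 i))) (prodE (fun i => pp (b 0 i))).
  rewrite !cox_val_prod -big_split; apply: eq_bigr => i _ /=.
  rewrite !cox_valX /= /np /pp; case: (b 0 i) => z /=.
    by rewrite mulr1 exprnP.
  rewrite NegzE -exprnN (mulVf (expf_neq0 _ (X0 i))).
  by rewrite expr0.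
have := congr1 cox_kill key; rewrite !rmorphM !rmorphXn /= !kA kc.
rewrite cox_kill_var eqxx !expr0n -/A -/A' /np /pp => kkey.
have rA0 t : t * A = 0 -> t = 0 by case/coxM_eq0.
move: kkey key; rewrite /np /pp.
have [b0|b0] := eqVneq (b 0 j) 0.
  rewrite b0 lexx absz0 !expr0 !eqxx /= !mul1r => kkey key.
  apply/eqP; rewrite -subr_eq0; apply/eqP/rA0.
  by rewrite mulrBl kkey key subrr.
have [bp|bn] := leP 0 (b 0 j).
  rewrite absz_eq0 (negbTE b0) eqxx /= mul0r mulr0 mul1r => kkey _.
  exact: rA0.
rewrite absz_eq0 (negbTE b0) eqxx /= !mul0r mulr0 expr0 !mul1r => /esym A'0.
rewrite A'0 mulrA => /rA0/coxM_eq0[->|/coxvarX_neq0 //].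
by rewrite rmorph0.
Qed.

Lemma cox_kill_degree b r : cox_degree b r -> cox_degree b (cox_kill r).
Proof.
move=> br; rewrite (cox_kill_homog br); case: ifP => _ //.
exact: cox_degree0.
Qed.

Lemma mpoly_killP (p : MP) : exists q : MP, p = mpoly_kill p + 'X_j * q.
Proof.
elim/mpolyind: p => [|c mon p _ _ [q pE]].
  by exists 0; rewrite /mpoly_kill rmorph0 mulr0 addr0.
have [t tE] : exists t : MP, 'X_[mon] = mpoly_kill 'X_[mon] + 'X_j * t.
  rewrite mpolyXE_id (bigD1 j) //=; set w := \prod_(i | _) _.
  have kw : mpoly_kill w = w.
    rewrite /mpoly_kill rmorph_prod; apply: eq_bigr => i /negbTE ij.
    by rewrite rmorphXn /= -/(mpoly_kill _) mpoly_killX ij.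
  have -> : mpoly_kill ('X_j ^+ mon j * w) =
      mpoly_kill 'X_j ^+ mon j * mpoly_kill w.
    by rewrite /mpoly_kill rmorphM rmorphXn.
  rewrite kw mpoly_killX eqxx; case: (mon j) => [|m].
    by exists 0; rewrite !expr0 mulr0 addr0.
  by exists ('X_j ^+ m * w); rewrite expr0n mul0r add0r exprS mulrA.
exists (c *: t + q).
rewrite {1}pE {1}tE /mpoly_kill linearP /= -!/(mpoly_kill _).
by rewrite scalerDr mulrDr -scalerAr addrACA.
Qed.

Lemma cox_kill_decomp r : {t | r = cox_kill r + Y j * t}.
Proof.
apply: cid; have [[p m] /= rE] := cox_repr r; have [q pE] := mpoly_killP p.
have qP : tofrac q / laurent_den k d e ^+ m \in @cox_pred k d e.
  by apply/asboolP; exists q, m.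
exists (CoxRing qP); apply: cox_val_inj.
rewrite cox_valD cox_valM (cox_killE rE) rE {1}pE tofracD tofracM /=.
by rewrite mulrDl mulrA.
Qed.

(** The difference quotient (r - r_0) / Y_j, where r_0 is r at Y_j = 0; it is unique because Y_j is
    not a zero divisor. *)
Definition cox_quo r : S := sval (cox_kill_decomp r).

Lemma cox_quoE r : r = cox_kill r + Y j * cox_quo r.
Proof. exact: svalP (cox_kill_decomp r). Qed.

Lemma cox_quo_unique r t : r = cox_kill r + Y j * t -> cox_quo r = t.
Proof.
by rewrite {1}(cox_quoE r) => /addrI; apply: coxvar_mulI.
Qed.

Lemma cox_quoD r s : cox_quo (r + s) = cox_quo r + cox_quo s.
Proof.
apply: cox_quo_unique; rewrite rmorphD /= mulrDr addrACA.
by rewrite -!cox_quoE.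
Qed.

(** A Leibniz rule twisted by [cox_kill]; it makes the scaling of [adjModule] associative and
    controls powers of B. *)
Lemma cox_quoM r s : cox_quo (r * s) = r * cox_quo s + cox_quo r * cox_kill s.
Proof.
apply: cox_quo_unique; rewrite rmorphM /= mulrDr addrCA [Y j * (r * _)]mulrCA.
by rewrite [Y j * (cox_quo r * _)]mulrA -mulrDl -cox_quoE -mulrDr addrC -cox_quoE.
Qed.

Lemma cox_quo1 : cox_quo 1 = 0.
Proof. by apply: cox_quo_unique; rewrite rmorph1 mulr0 addr0. Qed.

Lemma cox_quo_var : cox_quo (Y j) = 1.
Proof. by apply: cox_quo_unique; rewrite cox_kill_var eqxx add0r mulr1. Qed.

Lemma cox_quo_degree b r :
  cox_degree b r -> cox_degree (b - delta_mx 0 j) (cox_quo r).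
Proof.
move=> br; apply: coxvar_degree_div.
have -> : Y j * cox_quo r = r - cox_kill r.
  by rewrite {2}(cox_quoE r) addrAC subrr add0r.
by rewrite (cox_kill_homog br); case: ifP => _; rewrite ?subrr ?subr0 //;
  apply: cox_degree0.
Qed.

End KillVariable.
End CoxRingTheory.

(** * Homogeneous components and lifting into graded injectives *)

Lemma big_uniq_widen (I : eqType) (V : zmodType) (s u : seq I) (f : I -> V) :
  uniq s -> uniq u -> {subset s <= u} -> (forall a, a \notin s -> f a = 0) ->
  \sum_(a <- s) f a = \sum_(a <- u) f a.
Proof.
move=> us uu su f0; rewrite [RHS](bigID (mem s)) /= [X in _ + X]big1 // addr0.
rewrite -[RHS]big_filter; apply: perm_big; apply: uniq_perm => //.
  exact: filter_uniq.
by move=> a; rewrite mem_filter andb_idr // => /su.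
Qed.

Section GradedModuleTheory.
Variables (k : closedFieldType) (d e : nat).
Notation S := (coxRing k d e).
Notation Z := 'rV[int]_(d + e).
Implicit Types (M N E : gradedModule k d e) (a b : Z).

Lemma gm_compN M a (x : M) : gm_comp a x -> gm_comp a (- x).
Proof.
by move=> ax; rewrite -[- x]add0r; apply: gm_compB => //; apply: gm_comp0.
Qed.

Lemma gm_compD M a (x y : M) : gm_comp a x -> gm_comp a y -> gm_comp a (x + y).
Proof.
by move=> ax ay; rewrite -[y]opprK; apply: gm_compB => //; apply: gm_compN.
Qed.

Lemma gm_dec_off M (x : M) : {sf : seq Z * (Z -> M) |
  [/\ uniq sf.1, (forall a, gm_comp a (sf.2 a)),
      (forall a, a \notin sf.1 -> sf.2 a = 0) & x = \sum_(a <- sf.1) sf.2 a]}.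
Proof.
apply: cid; have [s [f [us cf ->]]] := gm_dec x.
exists (s, fun a => if a \in s then f a else 0); split=> //=.
- by move=> a; case: ifP => _ //; apply: gm_comp0.
- by move=> a /negbTE ->.
- by rewrite !big_seq; apply: eq_bigr => a ->.
Qed.

Definition gm_proj M a (x : M) : M := (sval (gm_dec_off x)).2 a.

Lemma gm_proj_unique M (x : M) (s : seq Z) (f : Z -> M) :
  uniq s -> (forall a, gm_comp a (f a)) -> (forall a, a \notin s -> f a = 0) ->
  x = \sum_(a <- s) f a -> forall a, gm_proj a x = f a.
Proof.
rewrite /gm_proj; case: (gm_dec_off x) => -[t g] /= [ut cg g0 xg] us cf f0 xf a.
pose u := undup (s ++ t).
have su : {subset s <= u} by move=> b bs; rewrite mem_undup mem_cat bs.
have tu : {subset t <= u} by move=> b bt; rewrite mem_undup mem_cat bt orbT.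
have uu : uniq u := undup_uniq _.
have [au|] := boolP (a \in u); last first.
  by rewrite mem_undup mem_cat negb_or => /andP[/f0 -> /g0 ->].
apply/eqP; rewrite -subr_eq0; apply/eqP.
apply: (@gm_indep _ _ _ M u (fun b => g b - f b)) au => // [b|].
  exact: gm_compB.
by rewrite sumrB -(big_uniq_widen ut uu tu g0) -(big_uniq_widen us uu su f0)
  -xg -xf subrr.
Qed.

Lemma gm_projP M a (x : M) : gm_comp a (gm_proj a x).
Proof. by rewrite /gm_proj; case: (gm_dec_off x) => sf []. Qed.

Lemma gm_proj_sum M (x : M) : exists2 s : seq Z, uniq s &
  forall u, uniq u -> {subset s <= u} -> x = \sum_(a <- u) gm_proj a x.
Proof.
rewrite /gm_proj; case: (gm_dec_off x) => -[s f] /= [us cf f0 ->].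
by exists s => // u uu su; apply: big_uniq_widen.
Qed.

Lemma gm_proj_off M (x : M) (s : seq Z) :
  (forall u, uniq u -> {subset s <= u} -> x = \sum_(a <- u) gm_proj a x) ->
  forall a, a \notin s -> gm_proj a x = 0.
Proof.
move=> xs a as_; have us : uniq (undup s) := undup_uniq _.
have uas : uniq (a :: undup s) by rewrite /= mem_undup as_.
have sas : {subset s <= a :: undup s} by move=> b bs; rewrite inE mem_undup bs orbT.
have su : {subset s <= undup s} by move=> b bs; rewrite mem_undup.
(* The sums over s and over s with a added both equal x, so the extra term is zero. *)
have := xs _ uas sas; rewrite big_cons -(xs _ us su) => xE.
by apply: (addIr x); rewrite add0r -xE.
Qed.

Fact gm_proj_is_zmod_morphism M a : zmod_morphism (@gm_proj M a).
Proof.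
move=> x y; have [s us xs] := gm_proj_sum x; have [t ut yt] := gm_proj_sum y.
pose u := undup (s ++ t).
have su : {subset s <= u} by move=> b bs; rewrite mem_undup mem_cat bs.
have tu : {subset t <= u} by move=> b bt; rewrite mem_undup mem_cat bt orbT.
apply: (@gm_proj_unique M (x - y) u (fun b => gm_proj b x - gm_proj b y)).
- exact: undup_uniq.
- by move=> b; apply: gm_compB; apply: gm_projP.
- move=> b; rewrite mem_undup mem_cat negb_or => /andP[bs bt].
  by rewrite (gm_proj_off xs) // (gm_proj_off yt) // subrr.
- by rewrite sumrB -xs ?undup_uniq // -yt ?undup_uniq.
Qed.

HB.instance Definition _ M a :=
  GRing.isZmodMorphism.Build M M (@gm_proj M a) (@gm_proj_is_zmod_morphism M a).

Lemma gm_proj_comp M a b (x : M) :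
  gm_comp a x -> gm_proj b x = if b == a then x else 0.
Proof.
move=> ax; apply: (@gm_proj_unique M x [:: a] (fun c => if c == a then x else 0)).
- by [].
- by move=> c; case: eqP => [->//|_]; apply: gm_comp0.
- by move=> c; rewrite inE => /negbTE ->.
- by rewrite big_seq1 eqxx.
Qed.

Lemma gm_proj_eq0 M (x : M) : (forall a, gm_proj a x = 0) -> x = 0.
Proof.
move=> x0; have [s us xs] := gm_proj_sum x.
by rewrite (xs s) // big1.
Qed.

Lemma gm_ind M (J : M -> Prop) :
  J 0 -> (forall x y, J x -> J y -> J (x + y)) ->
  forall x, (forall a, J (gm_proj a x)) -> J x.
Proof.
move=> J0 JD x Jx; have [s us xs] := gm_proj_sum x.
by rewrite (xs s) //; elim/big_ind: _.
Qed.

Lemma gm_proj_hom M N (f : gradedHom M N) a (x : M) :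
  gm_proj a (f x) = f (gm_proj a x).
Proof.
have [s us xs] := gm_proj_sum x.
apply: (@gm_proj_unique N (f x) s (fun b => f (gm_proj b x))) => //.
- by move=> b; apply: gh_degree; apply: gm_projP.
- by move=> b bs; rewrite (gm_proj_off xs) // linear0.
- by rewrite {1}(xs s) // linear_sum.
Qed.

Lemma gm_proj_scale M a b r (x : M) : cox_degree b r ->
  gm_proj a (r *: x) = r *: gm_proj (a - b) x.
Proof.
move=> br; have [s us xs] := gm_proj_sum x.
apply: (@gm_proj_unique M (r *: x) [seq c + b | c <- s]
  (fun c => r *: gm_proj (c - b) x)).
- by rewrite map_inj_uniq //; apply: addIr.
- move=> c; rewrite -[c in gm_comp c](subrK b); apply: gm_scale => //.
  exact: gm_projP.
- move=> c cs; rewrite (gm_proj_off xs) ?scaler0 //; apply: contra cs => cs.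
  by rewrite -[c](subrK b); apply: map_f.
- rewrite {1}(xs s) // scaler_sumr big_map.
  by apply: eq_bigr => c _; rewrite addrK.
Qed.

Lemma gradedSub_of_proj M (W : set M) : submod_closed (mem W) ->
  (forall a x, W x -> W (gm_proj a x)) ->
  {G : gradedSub M | forall x, G x <-> W x}.
Proof.
move=> Wsub Wpr; suff Wh : forall (s : seq Z) (f : Z -> M),
    uniq s -> (forall a, gm_comp a (f a)) -> W (\sum_(a <- s) f a) ->
    forall a, a \in s -> W (f a) by exists (GradedSub Wsub Wh).
move=> s f us cf Wf a sa; move: (Wpr a _ Wf).
rewrite raddf_sum /= (bigD1_seq a) //= big1 ?addr0.
  by rewrite (gm_proj_comp _ (cf a)) eqxx.
by move=> b ba; rewrite (gm_proj_comp _ (cf b)) eq_sym (negbTE ba).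
Qed.

Lemma gradedHom_of M N (f : M -> N) : linear f ->
  (forall a x, gm_comp a x -> gm_comp a (f x)) ->
  exists g : gradedHom M N, forall x, g x = f x.
Proof.
move=> flin fdeg.
pose fL := GRing.isLinear.Build S M N _ f flin.
pose F : {linear M -> N} := HB.pack f fL.
by exists (@GradedHom _ _ _ M N F fdeg).
Qed.

(** The map f descends to the image of u, a graded submodule of N, and extends from there by
    injectivity. A preimage of a homogeneous element may be replaced by its component of that
    degree, so the descended map is graded. *)
Lemma graded_injective_lift E M N (u : gradedHom M N) (f : gradedHom M E) :
  graded_injective E -> (forall x, u x = 0 -> f x = 0) ->
  exists g : gradedHom N E, forall x, g (u x) = f x.
Proof.
move=> injE uf.
pose Im : gradedModule k d e := subModule (Defs.image_sub u).
have [inc incE] : exists g : gradedHom Im N, forall x, g x = sub_val x.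
  by apply: gradedHom_of.
have uf' x y : u x = u y -> f x = f y.
  move=> /eqP; rewrite -subr_eq0 -linearB => /eqP/uf/eqP.
  by rewrite linearB subr_eq0 => /eqP.
have /choice[p pE] : forall y : Im, exists x, u x = sub_val y.
  by move=> y; have [x _ <-] := sub_valP y; exists x.
have [h hE] : exists g : gradedHom Im E, forall x, g x = f (p x).
  apply: gradedHom_of => [c x y|a x ax].
    by rewrite -linearP; apply: uf'; rewrite linearP !pE.
  suff -> : f (p x) = f (gm_proj a (p x)) by apply: gh_degree; apply: gm_projP.
  apply: uf'; rewrite -gm_proj_hom pE.
  by rewrite (gm_proj_comp a (ax : gm_comp a (sub_val x))) eqxx.
have [|g gE] := injE _ _ inc h.
  by move=> x y; rewrite !incE; apply: val_inj.
exists g => x.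
have xP : u x \in gs_pred (Defs.image_sub u) by apply: mem_set; exists x.
have := gE (SubCarrier xP); rewrite incE hE /= => ->.
by apply: uf'; rewrite pE.
Qed.

End GradedModuleTheory.

(** * Adjoining quotients by a variable; divisibility of graded injectives *)

Section AdjoinQuotient.
Variables (k : closedFieldType) (d e : nat) (j0 : 'I_d).
Notation S := (coxRing k d e).
Notation Z := 'rV[int]_(d + e).
Notation j := (lshift e j0).
Notation Y := (coxvar k j).
Notation dj := (delta_mx 0 j : Z).
Notation kill := (@cox_kill k d e j0).
Notation quo := (@cox_quo k d e j0).
Implicit Types (M E : gradedModule k d e) (a b : Z).

Section Construction.
Variable M : gradedModule k d e.

Definition adj_sort : Type := (M * M)%type.
HB.instance Definition _ := GRing.Zmodule.on adj_sort.
Implicit Types u v : adj_sort.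

Definition adj_scale (r : S) (u : adj_sort) : adj_sort :=
  (kill r *: u.1, r *: u.2 + quo r *: u.1).

Fact adj_scaleA r s u : adj_scale r (adj_scale s u) = adj_scale (r * s) u.
Proof.
rewrite /adj_scale /= rmorphM /= scalerA cox_quoM.
by rewrite scalerDr !scalerA scalerDl addrA.
Qed.

Fact adj_scale1 : left_id 1 adj_scale.
Proof.
by case=> x y; rewrite /adj_scale rmorph1 cox_quo1 !scale1r scale0r addr0.
Qed.

Fact adj_scaleDr : right_distributive adj_scale +%R.
Proof.
move=> r [x y] [x' y']; rewrite /adj_scale /= !scalerDr; congr pair.
by rewrite addrACA.
Qed.

Fact adj_scaleDl u : {morph adj_scale^~ u : r s / r + s}.
Proof.
case: u => x y r s; rewrite /adj_scale /= rmorphD cox_quoD !scalerDl; congr pair.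
by rewrite addrACA.
Qed.

HB.instance Definition _ := GRing.Zmodule_isLmodule.Build S adj_sort
  adj_scaleA adj_scale1 adj_scaleDr adj_scaleDl.

Definition adj_comp a : set adj_sort :=
  [set u | gm_comp (a + dj) u.1 /\ gm_comp a u.2].

Fact adj_comp0 a : adj_comp a 0.
Proof. by split; apply: gm_comp0. Qed.

Fact adj_compB a u v : adj_comp a u -> adj_comp a v -> adj_comp a (u - v).
Proof. by case=> ? ? [? ?]; split; apply: gm_compB. Qed.

Fact adj_compZ a b (r : S) u :
  cox_degree b r -> adj_comp a u -> adj_comp (a + b) (r *: u).
Proof.
move=> br [u1 u2]; split.
  by rewrite addrAC; apply: gm_scale => //; apply: cox_kill_degree.
apply: gm_compD; first exact: gm_scale.
have -> : a + b = a + dj + (b - dj) by rewrite addrACA subrr addr0.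
by apply: gm_scale => //; apply: cox_quo_degree.
Qed.

Lemma adj_sum (s : seq Z) (f : Z -> adj_sort) :
  \sum_(a <- s) f a = (\sum_(a <- s) (f a).1, \sum_(a <- s) (f a).2).
Proof.
elim: s => [|b s IH]; first by rewrite !big_nil.
by rewrite !big_cons IH.
Qed.

Fact adj_dec u : exists (s : seq Z) (f : Z -> adj_sort),
  [/\ uniq s, (forall a, adj_comp a (f a)) & u = \sum_(a <- s) f a].
Proof.
case: u => x y; have [s us xs] := gm_proj_sum x; have [t ut yt] := gm_proj_sum y.
exists (undup ([seq a - dj | a <- s] ++ t)),
  (fun a => (gm_proj (a + dj) x, gm_proj a y)).
split; first exact: undup_uniq.
  by move=> a; split; apply: gm_projP.
rewrite adj_sum /=; congr pair; last first.
  by rewrite -yt ?undup_uniq // => b bt; rewrite mem_undup mem_cat bt orbT.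
set w := undup _; rewrite -(big_map (+%R^~ dj) predT (fun a => gm_proj a x)) -xs //.
  by rewrite map_inj_uniq ?undup_uniq //; apply: addIr.
move=> b bs; rewrite -[b](subrK dj); apply: map_f.
by rewrite mem_undup mem_cat (map_f (fun c => c - dj) bs).
Qed.

Fact adj_indep (s : seq Z) (f : Z -> adj_sort) :
  uniq s -> (forall a, adj_comp a (f a)) -> \sum_(a <- s) f a = 0 ->
  forall a, a \in s -> f a = 0.
Proof.
move=> us cf; rewrite adj_sum => -[sf1 sf2] a sa.
have f2 : (f a).2 = 0.
  exact: (@gm_indep _ _ _ M s (fun b => (f b).2) us (fun b => (cf b).2) sf2 _ sa).
have f1 : (f a).1 = 0.
  have := @gm_indep _ _ _ M [seq b + dj | b <- s] (fun b => (f (b - dj)).1).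
  move=> /(_ _ _ _ (a + dj)); rewrite addrK; apply.
  - by rewrite map_inj_uniq //; apply: addIr.
  - by move=> b; have := (cf (b - dj)).1; rewrite subrK.
  - rewrite big_map -[RHS]sf1; apply: eq_bigr => b _; by rewrite addrK.
  - exact: map_f.
by rewrite [f a]surjective_pairing f1 f2.
Qed.

(* M, embedded as the second factor, with an element y / Y_j of degree a       *)
(* adjoined for every y of degree a + f_j. The ring S acts on y / Y_j by       *)
(* r (y / Y_j) = (r_0 y) / Y_j + r_1 y, where r = r_0 + Y_j r_1 and Y_j does   *)
(* not occur in r_0.                                                           *)
Definition adjModule : gradedModule k d e := @GradedModule k d e adj_sort
  adj_comp adj_comp0 adj_compB adj_compZ adj_dec adj_indep.

End Construction.

Variable B : homogeneousIdeal k d e.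
Notation Bpow := (ideal_pow (hi_set B)).

(** The generators of B are homogeneous, so each is either fixed or sent to 0. *)
Lemma hi_set_kill r : hi_set B r -> hi_set B (kill r).
Proof.
have [B0 BD BM] := ideal_genP (hi_gens B).
apply: (@smallest_sub _ _ _ [set s | hi_set B (kill s)]).
  split=> [|x y /= Bx By|c x /= Bx] /=; first by rewrite rmorph0.
    by rewrite rmorphD; apply: BD.
  by rewrite rmorphM; apply: BM.
move=> g Bg /=; have [b bg] := hi_homog Bg.
by rewrite (cox_kill_homog _ bg); case: ifP => _ //; move=> J [_]; apply.
Qed.

Lemma ideal_powM m (b c : S) : hi_set B b -> Bpow m c -> Bpow m.+1 (b * c).
Proof. by move=> Bb Bc J [_ JG]; apply: JG; exists b, c. Qed.

Lemma ideal_pow_kill m r : Bpow m r -> Bpow m (kill r).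
Proof.
elim: m r => // m IH; have [B0 BD BM] := ideal_powP (hi_set B) m.+1.
apply: (@smallest_sub _ _ _ [set s | Bpow m.+1 (kill s)]).
  split=> [|x y Bx By|c x Bx] /=; first by rewrite rmorph0.
    by rewrite rmorphD; apply: BD.
  by rewrite rmorphM; apply: BM.
move=> _ [b [c [Bb Bc ->]]] /=; rewrite rmorphM.
by apply: ideal_powM; [apply: hi_set_kill | apply: IH].
Qed.

(** By the Leibniz rule, a difference quotient differentiates one factor of a product and so costs
    one power of B. *)
Lemma ideal_pow_quo m r : Bpow m.+1 r -> Bpow m (quo r).
Proof.
elim: m r => // m IH r Br.
(* Membership of the element itself is carried along: the quotient of c x involves [kill x], which
   must be known to lie in the power of B. *)
suff [] : Bpow m.+2 r /\ Bpow m.+1 (quo r) by [].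
have [B0 BD BM] := ideal_powP (hi_set B) m.+1.
have [B0' BD' BM'] := ideal_powP (hi_set B) m.+2.
move: r Br; apply: (@smallest_sub _ _ _
  [set s | Bpow m.+2 s /\ Bpow m.+1 (quo s)]).
  split=> [|x y [Bx Bx'] [By By']|c x [Bx Bx']] /=; split=> //.
  - rewrite (_ : quo 0 = 0) //; apply: cox_quo_unique.
    by rewrite rmorph0 mulr0 addr0.
  - exact: BD'.
  - by rewrite cox_quoD; apply: BD.
  - exact: BM'.
  - rewrite cox_quoM; apply: BD; apply: BM => //.
    by apply: ideal_pow_kill; apply: (@ideal_pow_le _ _ _ _ m.+1 m.+2).
move=> _ [b [c [Bb Bc ->]]]; split; first exact: ideal_powM.
rewrite cox_quoM; apply: BD; first by apply: ideal_powM => //; apply: IH.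
by apply: BM; apply: ideal_pow_kill.
Qed.

(** The identity of E extends to a retraction g of [adjModule E] onto E, and g sends the formal
    quotient y / Y to the required element. If B^m kills y, then B^(m+1) kills y / Y, as [kill r]
    and [quo r] lie in B^m for r in B^(m+1). *)
Lemma injective_divisible E a (y : E) : graded_injective E ->
  gm_comp (a + dj) y ->
  exists x : E, [/\ gm_comp a x, Y *: x = y & torsion B E y -> torsion B E x].
Proof.
move=> injE ay.
have [i iE] : exists g : gradedHom E (adjModule E), forall x, g x = (0, x).
  apply: gradedHom_of => [c x x'|b x bx]; last by split=> //; apply: gm_comp0.
  by congr pair; rewrite /= ?scaler0 ?addr0.
have [f fE] : exists g : gradedHom E E, forall x, g x = x.
  exact: gradedHom_of.
have [|g gE] := injE _ _ i f; first by move=> x x'; rewrite !iE => -[].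
have gE' x : g (0, x) = x by rewrite -iE gE fE.
pose w : adjModule E := (y, 0); have wE r : r *: w = (kill r *: y, quo r *: y).
  by rewrite /w; congr pair; rewrite /= scaler0 add0r.
exists (g w); split.
- by apply: gh_degree; split=> //; apply: gm_comp0.
- by rewrite -linearZ wE cox_kill_var eqxx cox_quo_var scale0r scale1r gE'.
- case=> m ym; exists m.+1 => r Br.
  have k0 : kill r *: y = 0 by apply/ym/ideal_pow_kill; apply: ideal_pow_le Br.
  have q0 : quo r *: y = 0 by apply/ym/ideal_pow_quo.
  by rewrite -linearZ wE k0 q0; apply: linear0.
Qed.

End AdjoinQuotient.

(** * Slices: the annihilator of a variable in the degrees with fixed j-th entry *)

Section Slice.
Variables (k : closedFieldType) (d e : nat) (j0 : 'I_d) (c : int).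
Notation S := (coxRing k d e).
Notation Z := 'rV[int]_(d + e).
Notation j := (lshift e j0).
Notation Y := (coxvar k j).
Notation dj := (delta_mx 0 j : Z).
Implicit Types (M N E : gradedModule k d e) (a b : Z).

Definition slice_set M : set M :=
  [set x | Y *: x = 0 /\ forall a, a 0 j != c -> gm_proj a x = 0].

Fact slice_submod M : submod_closed (mem (@slice_set M)).
Proof.
split; first by apply: mem_set; split=> [|a _]; rewrite ?scaler0 ?raddf0.
have sl r (x : M) : slice_set x -> slice_set (r *: x).
  case=> Yx xc; split; first by rewrite scalerA mulrC -scalerA Yx scaler0.
  apply: (@cox_homog_ind k d e
    (fun r => forall a, a 0 j != c -> gm_proj a (r *: x) = 0)).
  - by move=> a _; rewrite scale0r raddf0.
  - by move=> s t sx tx a ac; rewrite scalerDl raddfD /= sx // tx // addr0.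
  (* A homogeneous scalar either leaves the j-th entry of degrees unchanged or is a multiple of Y_j,
     which kills x. *)
  move=> b s bs a ac; have [b0|b0] := eqVneq (b 0 j) 0.
    by rewrite (gm_proj_scale _ _ bs) xc ?scaler0 // !mxE b0 oppr0 addr0.
  rewrite (cox_quoE j0 s) (cox_kill_homog _ bs) (negbTE b0) add0r mulrC.
  by rewrite -scalerA Yx scaler0 raddf0.
move=> r x y /set_mem xs /set_mem [Yy yc]; apply: mem_set.
have [Yrx rxc] := sl r x xs; split; first by rewrite scalerDr Yrx Yy addr0.
by move=> a ac; rewrite raddfD /= rxc // yc // addr0.
Qed.

Fact slice_proj M a (x : M) : slice_set x -> slice_set (gm_proj a x).
Proof.
case=> Yx xc; split=> [|b bc]; last first.
  rewrite (gm_proj_comp _ (gm_projP a x)); case: eqP => // <-; exact: xc.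
have := gm_proj_scale (a + dj) x (cox_degree_var k j).
by rewrite Yx raddf0 addrK.
Qed.

Definition slice M : gradedSub M :=
  sval (gradedSub_of_proj (@slice_submod M) (@slice_proj M)).

Lemma sliceP M (x : M) : slice M x <-> slice_set x.
Proof. exact: (svalP (gradedSub_of_proj (@slice_submod M) (@slice_proj M))). Qed.

Lemma slice_homog M a (x : M) :
  a 0 j = c -> gm_comp a x -> Y *: x = 0 -> slice M x.
Proof.
move=> ac ax Yx; apply/sliceP; split=> // b bc.
by rewrite (gm_proj_comp _ ax) ifN //; apply: contra_neq bc => ->.
Qed.

Lemma slice_hom M N (f : gradedHom M N) (x : M) : slice M x -> slice N (f x).
Proof.
move=> /sliceP[Yx xc]; apply/sliceP; split=> [|a ac].
  by rewrite -linearZ Yx linear0.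
by rewrite gm_proj_hom xc ?linear0.
Qed.

(** * Exactness and contraction of the slices of an augmented resolution *)

Section Complex.
Variables (C : nat -> gradedModule k d e) (D : forall n, gradedHom (C n) (C n.+1)).
Hypothesis injC : forall n, graded_injective (C n.+1).
Hypothesis inj0 : forall x, D 0 x = 0 -> x = 0.
Hypothesis exactD : forall n x, D n.+1 x = 0 <-> exists y, D n y = x.
Hypothesis div0 : forall a (y : C 0), a 0 j = c -> gm_comp (a + dj) y ->
  exists2 x : C 0, gm_comp a x & Y *: x = y.
Hypothesis reg0 : forall a (x : C 0),
  a 0 j = c -> gm_comp a x -> Y *: x = 0 -> x = 0.

Lemma complexD n x : D n.+1 (D n x) = 0.
Proof. by apply/exactD; exists x. Qed.

Lemma complex_lift n a (x : C n.+1) : gm_comp a x -> D n.+1 x = 0 ->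
  exists2 y, gm_comp a y & D n y = x.
Proof.
move=> ax /exactD[y yE]; exists (gm_proj a y); first exact: gm_projP.
by rewrite -gm_proj_hom yE (gm_proj_comp _ ax) eqxx.
Qed.

Lemma complex_divisible n a (y : C n) : a 0 j = c -> gm_comp (a + dj) y ->
  exists2 x : C n, gm_comp a x & Y *: x = y.
Proof.
case: n y => [|n] y ac ay; first exact: div0 ay.
have [B _] : exists B : homogeneousIdeal k d e, True.
  by have @B : homogeneousIdeal k d e by [exists set0]; exists B.
by have [x []] := injective_divisible B (@injC n) ay; exists x.
Qed.

Lemma slice_exact n (x : C n.+1) : slice _ x -> D n.+1 x = 0 ->
  exists2 y, slice _ y & D n y = x.
Proof.
move=> xs Dx; apply: (@gm_ind _ _ _ (C n.+1)
    (fun x => exists2 y, slice _ y & D n y = x)).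
- by exists 0; [apply: gs0 | rewrite linear0].
- move=> _ _ [y ys <-] [y' ys' <-].
  by exists (y + y'); [apply: gsD | rewrite linearD].
move=> a; have [ac|ac] := eqVneq (a 0 j) c; last first.
  have /sliceP[_ xc] := xs; rewrite xc //.
  by exists 0; [apply: gs0 | rewrite linear0].
have Dxa : D n.+1 (gm_proj a x) = 0 by rewrite -gm_proj_hom Dx raddf0.
have [Yxa _] : slice_set (gm_proj a x) by apply: slice_proj; apply/sliceP.
have [y ay yE] := complex_lift (gm_projP a x) Dxa.
have aYy : gm_comp (a + dj) (Y *: y).
  by apply: gm_scale => //; apply: cox_degree_var.
have DYy : D n (Y *: y) = 0 by rewrite linearZ yE.
(* The preimage y need not be killed by Y; subtracting a cocycle z with Y z = Y y corrects it. In
   positive position, Y y = D z_0, and z = D (z_0 / Y) works. *)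
suff [z [az Yz Dz]] : exists z, [/\ gm_comp a z, Y *: z = Y *: y & D n z = 0].
  exists (y - z); last by rewrite linearB Dz subr0.
  apply: (slice_homog ac); first exact: gm_compB.
  by rewrite scalerBr Yz subrr.
case: n {x xs Dx Dxa Yxa yE} y ay aYy DYy => [|n] y ay aYy DYy.
  by exists 0; split; rewrite ?linear0 ?scaler0 ?(inj0 DYy) //; apply: gm_comp0.
have [z az zE] := complex_lift aYy DYy.
have [z' az' z'E] := complex_divisible ac az.
exists (D n z'); split; first exact: gh_degree.
  by rewrite -linearZ z'E.
exact: complexD.
Qed.

Lemma slice0_eq0 (x : C 0) : slice _ x -> x = 0.
Proof.
move=> xs; apply: gm_proj_eq0 => a; have [ac|ac] := eqVneq (a 0 j) c.
  apply: (reg0 ac); first exact: gm_projP.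
  by have /sliceP/(slice_proj a)[] := xs.
by have /sliceP[_ ->] := xs.
Qed.

(** Inductively, x - D (h x) vanishes on slice cocycles, so it factors through D on the slice and
    extends to g on the next slice, with g (D y) = y - D (h y). Every slice cocycle is such a D y,
    and D (g (D y)) = D y. *)
Lemma slice_contraction n :
  exists h : gradedHom (subModule (slice (C n.+1))) (C n),
  forall x, D n.+1 (sub_val x) = 0 -> D n (h x) = sub_val x.
Proof.
elim: n => [|n [h hP]].
  have [h hE] : exists h : gradedHom (subModule (slice (C 1))) (C 0),
      forall x, h x = 0.
    apply: gradedHom_of => [r x y|a x _]; last exact: gm_comp0.
    by rewrite scaler0 addr0.
  exists h => x /(slice_exact (sub_valP x))[y /slice0_eq0 -> <-].
  by rewrite hE !linear0.
have sD (x : C n.+1) : slice _ x -> slice _ (D n.+1 x) by apply: slice_hom.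
have [f fE] : exists f : gradedHom (subModule (slice (C n.+1))) (C n.+1),
    forall x, f x = sub_val x - D n (h x).
  apply: gradedHom_of => [r x y|a x ax].
    by rewrite (linearP h) (linearP (D n)) /= scalerBr opprD addrACA.
  by apply: gm_compB => //; apply: gh_degree; apply: gh_degree.
have [|g gE] := graded_injective_lift (u := restr_hom sD) (f := f) (@injC n).
  move=> x /(congr1 (@sub_val _ _ _ _ _)) /= Dx.
  by rewrite fE hP ?subrr.
exists g => x Dx; have [y ys yE] := slice_exact (sub_valP x) Dx.
have yP : y \in gs_pred (slice (C n.+1)) by apply: mem_set.
have -> : x = restr_hom sD (SubCarrier yP) by apply: val_inj.
by rewrite gE fE linearB complexD subr0.
Qed.

Lemma slice_boundary n a (x : C n.+1) : a 0 j = c -> gm_comp a x ->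
  Y *: x = 0 -> D n.+1 x = 0 ->
  exists y, [/\ gm_comp a y, Y *: y = 0, D n y = x &
    forall B, torsion B _ x -> torsion B _ y].
Proof.
move=> ac ax Yx Dx; have xP : x \in gs_pred (slice (C n.+1)).
  by apply/mem_set/(slice_homog ac).
have [h hP] := slice_contraction n; pose w := SubCarrier xP.
have h0 r : r *: x = 0 -> r *: h w = 0.
  move=> rx; rewrite -linearZ; have -> : r *: w = 0 by apply: val_inj.
  exact: linear0.
exists (h w); split.
- exact: gh_degree.
- exact: h0.
- exact: hP.
- by move=> B [m xm]; exists m => r /xm /h0.
Qed.

(** * The diagram chase in the torsion subcomplex *)

Variable B : homogeneousIdeal k d e.

(** At n = 0 the term [C 1] opens the unaugmented resolution, so only 0 is a boundary there, even
    though [C 0] maps to it. *)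
Definition torsion_boundary n (x : C n.+1) : Prop :=
  match n return C n.+1 -> Prop with
  | 0 => fun x => x = 0
  | n'.+1 => fun x => exists2 y : C n'.+1, torsion B _ y & D n'.+1 y = x
  end x.

Lemma torsion_proj M a (x : M) : torsion B M x -> torsion B M (gm_proj a x).
Proof.
move=> Wx; have [s us xs] := gm_proj_sum x.
have uas : uniq (undup (a :: s)) := undup_uniq _.
apply: (@gs_homog _ _ _ M (torsion B M) _ (fun b => gm_proj b x) uas).
- by move=> b; apply: gm_projP.
- by rewrite -xs // => b bs; rewrite mem_undup inE bs orbT.
- by rewrite mem_undup inE eqxx.
Qed.

(** If Y x = D y, divide the relevant component of y by Y to get a torsion z; then x - D z is a
    torsion cocycle killed by Y, hence the boundary of a torsion element. *)
Lemma torsion_boundary_reg n a (x : C n.+1) : a 0 j = c -> gm_comp a x ->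
  torsion B _ x -> D n.+1 x = 0 -> torsion_boundary (Y *: x) ->
  torsion_boundary x.
Proof.
move=> ac; case: n x => [|n] x ax Tx Dx /=.
  move=> Yx; have [y [ay Yy <- _]] := slice_boundary ac ax Yx Dx.
  by rewrite (reg0 ac ay Yy) linear0.
case=> y Ty yE.
have aYx : gm_comp (a + dj) (Y *: x).
  by apply: gm_scale => //; apply: cox_degree_var.
have [z [az Yz Tz]] := injective_divisible B (@injC n) (gm_projP (a + dj) y).
have {}Tz := Tz (torsion_proj (a + dj) Ty).
have YD : Y *: D n.+1 z = Y *: x.
  by rewrite -linearZ Yz -gm_proj_hom yE (gm_proj_comp _ aYx) eqxx.
have [||||t [_ _ tE Tt]] := @slice_boundary n.+1 a (x - D n.+1 z).
- by [].
- by apply: gm_compB => //; apply: gh_degree.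
- by rewrite scalerBr YD subrr.
- by rewrite linearB Dx complexD subr0.
exists (t + z); last by rewrite linearD tE subrK.
apply: (@gsD _ _ _ _ (torsion B (C n.+1))) => //; apply: Tt; apply: gsB => //.
exact: torsion_hom_subproof.
Qed.

(** A torsion quotient x = y / Y need not be a cocycle, but D x is killed by Y, so D x = D z with z
    torsion and Y z = 0; then x - z is the desired cocycle. *)
Lemma torsion_cycle_divisible n a (y : C n.+1) : a 0 j = c ->
  gm_comp (a + dj) y -> torsion B _ y -> D n.+1 y = 0 ->
  exists x, [/\ gm_comp a x, torsion B _ x, D n.+1 x = 0 & Y *: x = y].
Proof.
move=> ac ay Ty Dy.
have [x [ax Yx Tx]] := injective_divisible B (@injC n) ay.
have {}Tx := Tx Ty.
have [|||z [az Yz zE Tz]] := @slice_boundary n.+1 a (D n.+1 x) ac.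
- exact: gh_degree.
- by rewrite -linearZ Yx.
- exact: complexD.
exists (x - z); split.
- exact: gm_compB.
- by apply: gsB => //; apply: Tz; apply: torsion_hom_subproof.
- by rewrite linearB zE subrr.
- by rewrite scalerBr Yx Yz subr0.
Qed.

End Complex.
End Slice.

(** * Transfer to local cohomology *)

Section LocalCohomology.
Variables (k : closedFieldType) (d e : nat).
Notation Z := 'rV[int]_(d + e).
Variables (P : gradedModule k d e) (E : injectiveResolution P).

Definition aug_obj n : gradedModule k d e :=
  if n is m.+1 then E m else P.

Definition aug_diff n : gradedHom (aug_obj n) (aug_obj n.+1) :=
  match n with 0 => ir_aug E | m.+1 => ir_diff E m end.

Lemma aug_diff_exact n (x : aug_obj n.+1) :
  aug_diff n.+1 x = 0 <-> exists y, aug_diff n y = x.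
Proof.
case: n x => [|n] x; [rewrite ir_exact0 | rewrite ir_exact];
  by split=> [[y _ <-]|[y <-]]; exists y.
Qed.

Variable B : homogeneousIdeal k d e.

Lemma coboundariesP i (z : Gamma B (E i)) :
  coboundaries B E i z <-> torsion_boundary aug_diff B (sub_val z : aug_obj i.+1).
Proof.
case: i z => [|i] z /=; first by split=> [->//|z0]; apply: val_inj.
split=> [[y _ <-]|[y Ty yE]]; 
  first by exists (sub_val y) => //; apply: (sub_valP y).
have yP : y \in gs_pred (torsion B (E i)) by apply: mem_set.
by exists (SubCarrier yP) => //; apply: val_inj.
Qed.

Lemma local_cohomology_var_bij (j0 : 'I_d) (a : Z) (j := lshift e j0) i :
  (forall b : Z, b 0 j = a 0 j ->
    set_bij (@gm_comp _ _ _ P b) (@gm_comp _ _ _ P (b + delta_mx 0 j))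
            (fun x => coxvar k j *: x)) ->
  let H := local_cohomology B E i in
  set_bij (@gm_comp _ _ _ H a) (@gm_comp _ _ _ H (a + delta_mx 0 j))
          (fun x => coxvar k j *: x).
Proof.
move=> bijP H.
have injC n : graded_injective (aug_obj n.+1).
  by apply: (@ir_injective _ _ _ _ E n).
have inj0 (x : aug_obj 0) : aug_diff 0 x = 0 -> x = 0.
  by rewrite -(linear0 (ir_aug E)) => /ir_aug_inj.
have div0 (b : Z) (y : P) : b 0 j = a 0 j -> gm_comp (b + delta_mx 0 j) y ->
    exists2 x : P, gm_comp b x & coxvar k j *: x = y.
  by move=> ba yb; have [_ _ /(_ y yb)[x xb xE]] := bijP b ba; exists x.
have reg0 (b : Z) (x : P) :
    b 0 j = a 0 j -> gm_comp b x -> coxvar k j *: x = 0 -> x = 0.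
  move=> ba xb Yx; have [_ injY _] := bijP b ba.
  apply: injY; rewrite ?inE ?scaler0 //; exact: gm_comp0.
pose W := trace_sub (kernel (Gamma_hom B (ir_diff E i))) (coboundaries B E i).
have piZ r x : r *: (quot_pi W x : H) = quot_pi W (r *: x) by apply: quot_piZ.
(* Injectivity on classes reduces to this: a homogeneous cocycle whose multiple by Y is a coboundary
   is itself a coboundary. *)
have WY x : gm_comp a x -> W (coxvar k j *: x) -> W x.
  move=> ax /coboundariesP Wx; apply/coboundariesP.
  apply: (torsion_boundary_reg (j0 := j0) injC inj0 aug_diff_exact div0 reg0
    (erefl (a 0 j)) ax _ _ Wx).
    exact: sub_valP.
  by have /(congr1 (@sub_val _ _ _ _ _)) := sub_valP x.
split.
- move=> x ax; apply: gm_scale => //; exact: cox_degree_var.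
- move=> u v /set_mem au /set_mem av /= uv.
  have [x ax xE] := gm_compB au av.
  apply/eqP; rewrite -subr_eq0 -xE -(quot_pi0 W); apply/eqP/quot_piE.
  rewrite subr0; apply: WY => //.
  rewrite -[X in gs_set W X]subr0; apply/quot_piE; rewrite quot_pi0 -piZ xE.
  by rewrite scalerBr uv subrr.
move=> _ [y ay <-].
have Dy : aug_diff i.+1 (sub_val (sub_val y)) = 0.
  by have /(congr1 (@sub_val _ _ _ _ _)) := sub_valP y.
have [x [ax Tx Dx Yx]] := torsion_cycle_divisible (j0 := j0) injC inj0
  aug_diff_exact div0 reg0 (erefl (a 0 j)) ay (sub_valP (sub_val y)) Dy.
have xP : x \in gs_pred (torsion B (E i)) by apply: mem_set.
have xK : SubCarrier xP \in gs_pred (kernel (Gamma_hom B (ir_diff E i))).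
  by apply: mem_set; apply: val_inj.
exists (quot_pi W (SubCarrier xK)); first by exists (SubCarrier xK).
by rewrite piZ; congr quot_pi; apply: val_inj; apply: val_inj.
Qed.

End LocalCohomology.

(** * Invertible variables and the conclusion *)

Lemma graded_unit_bij (k : closedFieldType) (d e : nat) (M : gradedModule k d e)
    (i : 'I_e) (a : 'rV[int]_(d + e)) (j := rshift d i) :
  set_bij (@gm_comp _ _ _ M a) (@gm_comp _ _ _ M (a + delta_mx 0 j))
          (fun x => coxvar k j *: x).
Proof.
have [u Yu du] := coxvar_shift_inv k d i.
split=> [x ax|x y _ _ /(congr1 ( *:%R u))|y ay].
- by apply: gm_scale => //; apply: cox_degree_var.
- by rewrite !scalerA mulrC Yu !scale1r.
exists (u *: y); last by rewrite scalerA Yu scale1r.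
by rewrite -[a](addrK (delta_mx 0 j)); apply: gm_scale.
Qed.

Theorem proposition2p1 (R : realType) (k : closedFieldType) (n d e : nat)
    (Delta : fan R n) (tau : 'I_d -> set 'rV[R]_n)
    (Htau : enumerates_rays Delta tau) (He : has_span_codim Delta e)
    (I : set int) (P : gradedModule k d e) (HP : I_homogeneous I P)
    (E : injectiveResolution P) (i : nat) :
  I_homogeneous I (local_cohomology (irrelevant_ideal k e Delta tau) E i).
Proof.
move=> j a; rewrite -[j](splitK j); case: (fintype.split j) => [j0|j0] /= aI.
  by apply: local_cohomology_var_bij => b ba; apply: HP; rewrite ba.
exact: (@graded_unit_bij _ _ _
  (local_cohomology (irrelevant_ideal k e Delta tau) E i) j0 a).
Qed.
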